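(* Let $G$ be an FPF group. Then $G$ admits a unique irreducible rational FPF representation up to isomorphism; that is, up to isomorphism of $\mathbb{Q}[G]$-modules there is exactly one simple $\mathbb{Q}[G]$-module $V$ such that $\det(g-\mathrm{id}\mid V)\neq 0$ for every non-identity $g\in G$.
   Context: A representation $\rho\colon G\to \operatorname{GL}(V)$ of a finite group $G$ on a nonzero finite-dimensional vector space $V$ over $\mathbb{C}$ (respectively over $\mathbb{Q}$) is called FPF (fixed-point-free) if $\det(\rho(g)-\mathrm{id})\neq 0$ for every non-identity $g\in G$. A finite group $G$ is called an FPF group if it admits an FPF complex representation (on a nonzero space). A rational FPF representation is an FPF representation over $\mathbb{Q}$. *)

(* Defs.v *)
From HB Require Import structures.
From mathcomp Require Import all_boot all_order all_algebra all_fingroup.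
From mathcomp Require Import mxrepresentation.
From mathcomp Require Import complex reals.
Set Implicit Arguments.
Unset Strict Implicit.
Unset Printing Implicit Defensive.
Import GRing.Theory.
Local Open Scope ring_scope.

(* The representation space is F^n; the condition 0 < n says it is nonzero. *)
Definition FPF (F : fieldType) (gT : finGroupType) (G : {group gT}) (n : nat)
    (rG : mx_representation F G n) : Prop :=
  (0 < n)%N /\
  forall g : gT, g \in G -> g != 1%g -> \det (rG g - 1%:M) != 0.

(* For R : realType, R[i] is the field of complex numbers; different choices   *)
(* of R give isomorphic fields.                                                *)
Definition FPF_group (R : realType) (gT : finGroupType) (G : {group gT}) : Prop :=
  exists (n : nat) (rG : mx_representation (complex R) G n), FPF rG.

Definition irr_rat_FPF (gT : finGroupType) (G : {group gT}) (n : nat)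
    (rG : mx_representation rat G n) : Prop :=
  mx_irreducible rG /\ FPF rG.

(* Main.v *)
(** A representation is FPF iff the norm [\sum_(y in <[x]>) y] of every
    non-identity [x] acts as zero. The vectors killed by all norms form a
    submodule of the regular module, cut out by linear equations with rational
    coefficients; it is nonzero over [C] since an FPF complex module maps
    nontrivially to the regular module, hence it is nonzero over [Q], and any
    simple submodule of it is FPF.

    For uniqueness, in an FPF representation the eigenvalues of [x] are
    primitive roots of unity of order [#[x]], so over [Q] the characteristic
    polynomial of [x] is a power of the cyclotomic polynomial of index [#[x]].
    Hence the characters of two rational FPF representations are proportional,
    they are not orthogonal, and Schur's lemma applies. *)
Require Import Defs.
From HB Require Import structures.
From mathcomp Require Import all_boot all_order all_algebra all_fingroup.
From mathcomp Require Import cyclic algC cyclotomic.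
From mathcomp Require Import mxrepresentation.
From mathcomp Require Import complex reals.
From Stdlib Require Import Classical.
Set Implicit Arguments.
Unset Strict Implicit.
Unset Printing Implicit Defensive.
Import Order.TTheory GroupScope GRing.Theory Num.Theory.
Local Open Scope ring_scope.

(** * Averaged intertwiners and Schur's lemma *)

Section Intertwiners.

Variables (F : fieldType) (gT : finGroupType) (G : {group gT}).

Lemma mx_average_hom n m (rG : mx_representation F G n)
    (rH : mx_representation F G m) (A : 'M_(n, m)) g : g \in G ->
  rG g *m (\sum_(x in G) rG x^-1%g *m A *m rH x) =
  (\sum_(x in G) rG x^-1%g *m A *m rH x) *m rH g.
Proof.
move=> Gg; rewrite mulmx_sumr mulmx_suml.
rewrite (reindex_acts 'R _ Gg) ?astabsR //=; apply: eq_bigr => x Gx.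
rewrite invMg !repr_mxM ?groupV ?groupM // !mulmxA.
by rewrite -repr_mxM ?groupV // mulgV repr_mx1 mul1mx.
Qed.

(** Average each matrix unit over [G]: entry [(i, j)] of the average of [delta_mx i j] is the sum of
    products of diagonal entries [i] of [rG x^-1] and [j] of [rH x]. Summed over [i] and [j] these
    give the trace sum, so some average is nonzero. *)
Lemma mxtrace_neq0_hom n m (rG : mx_representation F G n)
    (rH : mx_representation F G m) :
    \sum_(x in G) \tr (rG x^-1%g) * \tr (rH x) != 0 ->
  exists2 B : 'M_(n, m), B != 0 & {in G, forall g, rG g *m B = B *m rH g}.
Proof.
move=> tr_neq0.
pose B i j := \sum_(x in G) rG x^-1%g *m delta_mx i j *m rH x : 'M_(n, m).
have [/existsP[i /existsP[j Bij]] | B0] :=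
  boolP [exists i, exists j, B i j != 0].
  by exists (B i j) => // g; apply: mx_average_hom.
case/negP: tr_neq0; apply/eqP.
transitivity (\sum_i \sum_j B i j i j); last first.
  apply: big1 => i _; apply: big1 => j _.
  move: B0 => /existsPn/(_ i)/existsPn/(_ j)/negPn/eqP->.
  by rewrite mxE.
under [RHS]eq_bigr do under eq_bigr do rewrite summxE.
under [RHS]eq_bigr do rewrite exchange_big.
rewrite exchange_big; apply: eq_bigr => x Gx /=.
rewrite /mxtrace mulr_suml; apply: eq_bigr => i _.
rewrite mulr_sumr; apply: eq_bigr => j _.
rewrite mxE (bigD1 j) //= big1 => [|k kj]; rewrite mxE (bigD1 i) //= big1.
- by rewrite mxE !eqxx mulr1 !addr0.
- by move=> k ki; rewrite mxE (negPf ki) mulr0.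
- by rewrite mxE eqxx (negPf kj) mulr0 addr0 mul0r.
by move=> l li; rewrite mxE (negPf li) mulr0.
Qed.

Lemma mx_irr_hom_rsim n m (rG : mx_representation F G n)
    (rH : mx_representation F G m) (B : 'M_(n, m)) :
    mx_irreducible rG -> mx_irreducible rH -> B != 0 ->
    {in G, forall g, rG g *m B = B *m rH g} ->
  mx_rsim rG rH.
Proof.
move=> /mx_irrP[_ irrG] /mx_irrP[_ irrH] nzB homB.
have freeB: row_free B.
  rewrite -kermx_eq0; apply: contraR nzB => /irrG; rewrite -sub1mx => kerB.
  suffices /kerB/sub_kermxP: mxmodule rG (kermx B) by rewrite mul1mx => ->.
  apply/mxmoduleP=> x Gx; apply/sub_kermxP.
  by rewrite -mulmxA homB // mulmxA mulmx_ker mul0mx.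
have fullB: row_full B.
  have := irrH <<B>>%MS; rewrite (eqmx_module _ (genmxE B)).
  rewrite (eqmx_eq0 (genmxE B)) /row_full (genmxE B) => -> //.
  by apply/mxmoduleP=> x Gx; rewrite -homB // submxMl.
by exists B => //; rewrite -(eqP freeB) (eqP fullB).
Qed.

End Intertwiners.

(** * Norms of cyclic subgroups and the FPF condition *)

Section Norms.

Variables (gT : finGroupType) (G : {group gT}).

(** If [z] has order [m], then [x ^+ m] fixes the eigenvector, so it must be the identity. *)
Lemma fpf_eigenvalue (F : fieldType) n (rG : mx_representation F G n) x z :
  FPF rG -> x \in G -> eigenvalue (rG x) z -> #[x]%g.-primitive_root z.
Proof.
case=> _ fpfG Gx /eigenvalueP[v vx nzv].
have vX k: v *m rG (x ^+ k)%g = z ^+ k *: v.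
  elim: k => [|k IHk]; first by rewrite repr_mx1 mulmx1 scale1r.
  by rewrite expgSr repr_mxM ?groupX // mulmxA IHk -scalemxAl vx scalerA exprSr.
have zx: z ^+ #[x]%g = 1.
  apply/eqP; rewrite -subr_eq0; have := vX #[x]%g.
  rewrite expg_order repr_mx1 mulmx1 => /esym/eqP.
  by rewrite -{2}[v]scale1r -subr_eq0 -scalerBl scaler_eq0 (negPf nzv) orbF.
have [m prim_m m_dv] := prim_order_exists (order_gt0 x) zx.
suff xm: (x ^+ m = 1)%g.
  have: (#[x] %| m)%N by rewrite order_dvdn xm.
  by move=> dv_m; have/eqP->: #[x]%g == m by rewrite eqn_dvd dv_m.
apply: contraNeq nzv => /(fpfG _ (groupX m Gx)); apply: contraNT => nzv.
apply/det0P; exists v => //.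
by rewrite mulmxBr mulmx1 vX (prim_expr_order prim_m) scale1r subrr.
Qed.

Lemma fpf_map (aF rF : fieldType) (f : {rmorphism aF -> rF}) n
    (rG : mx_representation aF G n) : FPF rG -> FPF (map_repr f rG).
Proof.
case=> n_gt0 fpfG; split=> // x Gx ntx.
by rewrite map_reprE -(map_mx1 f) -map_mxB det_map_mx fmorph_eq0 fpfG.
Qed.

(** Multiplication by [x] permutes [<[x]>], so [rG x - 1%:M], which is invertible, kills the
    norm. *)
Lemma fpf_norm (F : fieldType) n (rG : mx_representation F G n) x :
  FPF rG -> x \in G^# -> \sum_(y in <[x]>%g) rG y = 0.
Proof.
case=> _ fpfG /setD1P[ntx Gx]; have sxG: <[x]>%g \subset G by rewrite cycle_subG.
have := fpfG x Gx ntx; rewrite -unitfE -/(rG x - 1%:M \in unitmx) => Ux.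
apply: (can_inj (mulKmx Ux)); rewrite mulmx0 mulmxBl mul1mx mulmx_sumr.
rewrite [X in _ - X](reindex_inj (mulgI x)) /=.
rewrite [X in _ - X](eq_bigl (mem <[x]>%g)); last first.
  by move=> y; rewrite groupMl ?cycle_id.
rewrite -sumrB big1 // => y xy.
by rewrite repr_mxM ?subrr // (subsetP sxG).
Qed.

(** On a vector fixed by [x] the norm acts as the scalar [#[x]], nonzero in characteristic zero. *)
Lemma norm_fpf (F : numFieldType) n (rG : mx_representation F G n) :
    (0 < n)%N -> {in G^#, forall x, \sum_(y in <[x]>%g) rG y = 0} -> FPF rG.
Proof.
move=> n_gt0 norm0; split=> // x Gx ntx; apply/negP=> /det0P[v nzv].
move/eqP; rewrite mulmxBr mulmx1 subr_eq0 => /eqP vx.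
have vX k: v *m rG (x ^+ k)%g = v.
  elim: k => [|k IHk]; first by rewrite repr_mx1 mulmx1.
  by rewrite expgSr repr_mxM ?groupX // mulmxA IHk.
have := norm0 x; rewrite !inE ntx => /(_ Gx)/(congr1 (mulmx v)).
rewrite mulmx0 mulmx_sumr (eq_bigr (fun=> v)) => [|_ /cycleP[k ->]] //.
rewrite sumr_const => /eqP; rewrite -scaler_nat scaler_eq0 (negPf nzv) orbF.
by rewrite pnatr_eq0 -[#|_|]/#[x]%g -leqn0 leqNgt order_gt0.
Qed.

(** Built from kernels and intersections only, so that it commutes with extension of scalars. *)
Definition norm_ker (F : fieldType) n (rG : mx_representation F G n) : 'M_n :=
  (\bigcap_(x in G^#) kermx (\sum_(y in <[x]>%g) rG y))%MS.

Lemma norm_kerP (F : fieldType) n (rG : mx_representation F G n) m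
    (A : 'M_(m, n)) :
  reflect {in G^#, forall x, A *m \sum_(y in <[x]>%g) rG y = 0}
          (A <= norm_ker rG)%MS.
Proof.
apply: (iffP sub_bigcapmxP) => [sA x /sA /sub_kermxP //|A0 x /A0 Ax].
exact/sub_kermxP.
Qed.

Lemma norm_ker_module (F : fieldType) n (rG : mx_representation F G n) :
  mxmodule rG (norm_ker rG).
Proof.
apply/mxmoduleP=> g Gg; apply/norm_kerP=> x /setD1P[ntx Gx].
(* Moving [rG g] past the norm of [x] turns it into the norm of this conjugate, which also kills
   [norm_ker rG]. *)
have Gxg: (x ^ g^-1)%g \in G^# by rewrite !inE conjg_eq1 ntx groupJ ?groupV.
have /norm_kerP/(_ _ Gxg) := submx_refl (norm_ker rG).
move/(congr1 (mulmxr (rG g))) => /=; rewrite mul0mx => U0.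
rewrite -[RHS]U0 -!mulmxA; congr (_ *m _); rewrite mulmx_sumr mulmx_suml.
rewrite [RHS](reindex_inj (conjg_inj g^-1%g)) /=.
rewrite [RHS](eq_bigl (mem <[x]>%g)); last first.
  by move=> y; rewrite cycleJ memJ_conjg.
apply: eq_bigr => y xy; have Gy: y \in G.
  by apply: subsetP xy; rewrite cycle_subG.
by rewrite -!repr_mxM ?groupJ ?groupV // conjgE invgK !mulgA mulgKV.
Qed.

Lemma map_norm_ker (aF rF : fieldType) (f : {rmorphism aF -> rF}) n
    (rG : mx_representation aF G n) :
  (map_mx f (norm_ker rG) :=: norm_ker (map_repr f rG))%MS.
Proof.
rewrite /norm_ker; elim/big_rec2: _ => [|x A B _ AB]; first by rewrite map_mx1.
apply: eqmx_trans (map_capmx f _ _) (cap_eqmx _ AB).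
rewrite map_kermx raddf_sum; apply: eqmx_refl.
Qed.

Lemma fpf_regular_norm_ker (F : fieldType) n (rG : mx_representation F G n) :
  FPF rG -> norm_ker (regular_repr F G) != 0.
Proof.
move=> fpfG; have n_gt0 := fpfG.1.
(* Matrix coefficients of column 0: row [i] is the function [y |-> rG y^-1 i 0] on [G]. The inverse
   makes [A] commute with right translation, and the column at [y = 1] shows that [A] is nonzero. *)
pose A := \matrix_(i, j) rG (enum_val j)^-1%g i (Ordinal n_gt0) : 'M_(n, #|G|).
have homA g: g \in G -> rG g *m A = A *m regular_repr F G g.
  move=> Gg; apply/matrixP=> i j; pose y := enum_val j.
  have Gy: y \in G by apply: enum_valP.
  transitivity (rG (g * y^-1)%g i (Ordinal n_gt0)).
    rewrite repr_mxM ?groupV // !mxE; apply: eq_bigr => k _; by rewrite mxE.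
  rewrite mxE (bigD1 (gring_index G (y * g^-1))) //= big1 ?addr0 => [|k].
    rewrite !mxE gring_indexK ?groupM ?groupV // mulgKV gring_valK !eqxx mulr1.
    by rewrite invMg invgK.
  apply: contraNeq; rewrite !mxE eqxx /=.
  case: (j =P _) => [def_j _|]; last by rewrite mulr0 eqxx.
  rewrite /y def_j gring_indexK ?mulgK.
    by rewrite gring_valK.
  by rewrite groupM ?enum_valP.
have nzA: A != 0.
  apply/eqP=> /matrixP/(_ (Ordinal n_gt0) (gring_index G 1%g))/eqP.
  by rewrite !mxE gring_indexK // invg1 repr_mx1 mxE eqxx oner_eq0.
apply: contraNneq nzA => ker0; rewrite -submx0 -ker0.
apply/norm_kerP => x G'x; rewrite mulmx_sumr.
transitivity ((\sum_(y in <[x]>%g) rG y) *m A); last by rewrite fpf_norm ?mul0mx.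
rewrite mulmx_suml; apply: eq_bigr => y xy; rewrite homA //.
by apply: subsetP xy; rewrite cycle_subG; case/setD1P: G'x.
Qed.

Lemma submod_norm_fpf (F : numFieldType) n (rG : mx_representation F G n)
    (U : 'M_n) (modU : mxmodule rG U) :
  U != 0 -> (U <= norm_ker rG)%MS -> FPF (submod_repr modU).
Proof.
move=> nzU /norm_kerP U0; apply: norm_fpf; first by rewrite lt0n mxrank_eq0.
move=> x G'x; have sxG: <[x]>%g \subset G.
  by rewrite cycle_subG; case/setD1P: G'x.
apply: (@val_submod_inj _ _ U); rewrite raddf_sum linear0 /=.
transitivity (val_submod (1%:M : 'M_(\rank U)) *m \sum_(y in <[x]>%g) rG y).
  rewrite mulmx_sumr; apply: eq_bigr => y xy.
  by rewrite -val_submodJ ?mul1mx // (subsetP sxG).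
have /submxP[B ->]: (val_submod (1%:M : 'M_(\rank U)) <= U)%MS.
  exact: val_submodP.
by rewrite -mulmxA U0 ?mulmx0.
Qed.

End Norms.

(** * Characteristic polynomials and traces over the rationals *)

Section RationalTraces.

Local Notation pQtoC := (map_poly (ratr : rat -> algC)).

(** All primitive [n]-th roots of unity have the cyclotomic polynomial as minimal polynomial, so one
    [p] serves every [z]. *)
Lemma primitive_root_rat_minpoly n : (0 < n)%N ->
  exists p : {poly rat}, [/\ p \is monic, (1 < size p)%N &
    forall z q, n.-primitive_root z -> root (pQtoC q) z = (p %| q)].
Proof.
case/C_prim_root_exists=> z prim_z; have [p [Dp mon_p] dv_p] := minCpolyP z.
exists p; split=> // [|w q prim_w].
  by rewrite -(size_map_poly (ratr : {rmorphism rat -> algC})) -Dp size_minCpoly.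
have [p' [Dp' _] dv_p'] := minCpolyP w; rewrite dv_p'; congr (_ %| _).
apply: (map_poly_inj (ratr : {rmorphism rat -> algC})) => /=.
rewrite -Dp -Dp' (minCpoly_cyclotomic prim_z) (minCpoly_cyclotomic prim_w).
by rewrite -(Cintr_Cyclotomic prim_z) -(Cintr_Cyclotomic prim_w).
Qed.

Lemma monic_primitive_roots_exp n (p q : {poly rat}) :
    p \is monic -> (1 < size p)%N ->
    (forall z r, n.-primitive_root z -> root (pQtoC r) z = (p %| r)) ->
    q \is monic -> (forall z, root (pQtoC q) z -> n.-primitive_root z) ->
  exists k, q = p ^+ k.
Proof.
move=> mon_p p_gt1 dv_p; have [s] := ubnP (size q).
elim: s q => // s IHs q le_qs mon_q prim_q.
have [q1 | q_neq1] := eqVneq (size q) 1%N.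
  exists 0%N; rewrite expr0 [q]size1_polyC ?q1 //.
  by move/monicP: mon_q; rewrite lead_coefE q1 => ->.
have /closed_rootP[z qz]: size (pQtoC q) != 1%N by rewrite size_map_poly.
have /dvdpP[r Dq]: p %| q by rewrite -(dv_p z) // prim_q.
have mon_r: r \is monic by rewrite -(monicMr _ mon_p) -Dq.
have [|||k Dr] := IHs r; last by exists k.+1; rewrite Dq Dr exprSr.
- rewrite -ltnS; apply: leq_trans le_qs.
  rewrite Dq size_Mmonic ?monic_neq0 //.
  by rewrite -(subnKC p_gt1) !addnS /= ltnS leq_addr.
- by [].
by move=> w rw; apply: prim_q; rewrite Dq rmorphM rootM rw.
Qed.

(** The degrees are [a.+1] and [b.+1], so this is the coefficient just below the leading one. For a
    characteristic polynomial it is minus the trace. *)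
Lemma monic_subleadM (R : nzRingType) (p q : {poly R}) a b :
    p \is monic -> q \is monic -> size p = a.+2 -> size q = b.+2 ->
  (p * q)`_(a + b).+1 = p`_a + q`_b.
Proof.
move=> /monicP mon_p /monicP mon_q sp sq.
rewrite lead_coefE sp /= in mon_p; rewrite lead_coefE sq /= in mon_q.
have lt_a: (a < (a + b).+2)%N by rewrite ltnS leqW ?leq_addr.
have lt_a1: (a.+1 < (a + b).+2)%N by rewrite !ltnS leq_addr.
rewrite coefM (bigD1 (Ordinal lt_a)) //= (bigD1 (Ordinal lt_a1)) /=; last first.
  by rewrite -val_eqE /= gtn_eqF.
have def_b1: ((a + b).+1 - a = b.+1)%N by rewrite -addnS addKn.
rewrite subSS addKn def_b1 mon_p mon_q mulr1 mul1r big1 ?addr0 //.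
move=> i /andP[]; rewrite -!val_eqE /= => ia ia1.
have [lt_ia | ] := ltnP i a.
  rewrite [q`__]nth_default ?mulr0 // sq ltn_subRL addnS.
  by rewrite ltnS ltn_add2r.
rewrite leq_eqVlt eq_sym (negPf ia) leq_eqVlt eq_sym (negPf ia1) /= => lt_i.
by rewrite [p`__]nth_default ?mul0r // sp.
Qed.

Lemma size_monic_exp (R : nzRingType) (p : {poly R}) a k :
  p \is monic -> size p = a.+1 -> size (p ^+ k) = (k * a).+1.
Proof.
move=> mon_p sp; elim: k => [|k IHk]; first by rewrite expr0 size_poly1.
rewrite exprS size_monicM ?monic_neq0 ?rpredX // IHk sp addnS mulSn.
by rewrite addSn.
Qed.

Lemma monic_subleadX (R : nzRingType) (p : {poly R}) a k :
  p \is monic -> size p = a.+2 -> (p ^+ k.+1)`_(k.+1 * a.+1).-1 = p`_a *+ k.+1.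
Proof.
move=> mon_p sp; elim: k => [|k IHk]; first by rewrite mul1n.
have mon_k: p ^+ k.+1 \is monic by rewrite rpredX.
have sz_k: size (p ^+ k.+1) = (k.+1 * a.+1).-1.+2.
  by rewrite (size_monic_exp _ mon_p sp) prednK ?muln_gt0.
rewrite exprS mulrS -IHk -(monic_subleadM mon_p mon_k sp sz_k).
by rewrite -addnS prednK ?muln_gt0 // [in LHS]mulSn.
Qed.

Variables (gT : finGroupType) (G : {group gT}).

Lemma rat_fpf_char_poly n (rG : mx_representation rat G n) x p :
    FPF rG -> x \in G -> p \is monic -> (1 < size p)%N ->
    (forall z r, #[x]%g.-primitive_root z -> root (pQtoC r) z = (p %| r)) ->
  exists k, char_poly (rG x) = p ^+ k.
Proof.
move=> fpfG Gx mon_p p_gt1 dv_p.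
apply: (monic_primitive_roots_exp mon_p p_gt1 dv_p (char_poly_monic _)) => z.
rewrite map_char_poly -eigenvalue_root_char -map_reprE.
exact: fpf_eigenvalue (fpf_map _ fpfG) Gx.
Qed.

Lemma rat_fpf_trace n m (rG : mx_representation rat G n)
    (rH : mx_representation rat G m) x y :
    FPF rG -> FPF rH -> x \in G -> y \in G -> #[x]%g = #[y]%g ->
  \tr (rG x) *+ m = \tr (rH y) *+ n.
Proof.
move=> fpfG fpfH Gx Gy oxy.
have [p [mon_p p_gt1 dv_p]] := primitive_root_rat_minpoly (order_gt0 x).
have [a sp]: {a | size p = a.+2} by exists (size p - 2)%N; rewrite -addn2 subnK.
have tr_p d (r : mx_representation rat G d) g : FPF r -> g \in G ->
    #[g]%g = #[x]%g -> exists2 k, d = (k * a.+1)%N & \tr (r g) = - p`_a *+ k.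
- move=> fpf_r Gg og; have d_gt0 := fpf_r.1; rewrite -og in dv_p.
  have [k Dr] := rat_fpf_char_poly fpf_r Gg mon_p p_gt1 dv_p.
  have Dd: d = (k * a.+1)%N.
    have := size_char_poly (r g).
    by rewrite Dr (size_monic_exp _ mon_p sp) => -[->].
  (* A zero exponent would force dimension 0, which FPF excludes. *)
  exists k => //; case: k => [|k] in Dr Dd *; first by rewrite Dd in d_gt0.
  by rewrite mulNrn -(monic_subleadX k mon_p sp) -Dr -Dd char_poly_trace ?opprK.
have [k Dn ->] := tr_p _ _ _ fpfG Gx erefl.
have [l Dm ->] := tr_p _ _ _ fpfH Gy (esym oxy).
by rewrite Dn Dm -!mulrnA mulnCA.
Qed.

Lemma rat_fpf_rsim n m (rG : mx_representation rat G n)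
    (rH : mx_representation rat G m) :
  irr_rat_FPF rG -> irr_rat_FPF rH -> mx_rsim rG rH.
Proof.
move=> [irrG fpfG] [irrH fpfH].
have [n_gt0 m_gt0] : (0 < n)%N /\ (0 < m)%N by split; [case: fpfG | case: fpfH].
have [|B nzB homB] := @mxtrace_neq0_hom _ _ G _ _ rG rH.
  (* Since [x^-1] and [x] have the same order, [m] times the trace sum is [n] times the sum of the
     squares of [\tr (rH x)]. It is positive because the term at 1 is the square of [m]. *)
  apply/eqP=> /(congr1 (fun c => c *+ m)); rewrite mul0rn -sumrMnl.
  rewrite (eq_bigr (fun x => \tr (rH x) ^+ 2 *+ n)) => [|x Gx]; last first.
    rewrite -mulrnAl (rat_fpf_trace fpfG fpfH (y := x)) ?groupV ?orderV //.
    by rewrite mulrnAl.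
  apply/eqP; rewrite gt_eqF // sumrMnl pmulrn_lgt0 //.
  rewrite (bigD1 1%g) //= repr_mx1 mxtrace1 ltr_wpDr ?exprn_gt0 ?ltr0n //.
  by apply: sumr_ge0 => x _; rewrite sqr_ge0.
exact: mx_irr_hom_rsim nzB homB.
Qed.

End RationalTraces.

Theorem theorem0p1 (R : realType) (gT : finGroupType) (G : {group gT}) :
  FPF_group R G ->
  exists (n : nat) (rG : mx_representation rat G n),
    irr_rat_FPF rG /\
    forall (m : nat) (rH : mx_representation rat G m),
      irr_rat_FPF rH -> mx_rsim rH rG.
Proof.
case=> n [rC fpfC].
have nzU: norm_ker (regular_repr rat G) != 0.
  have := fpf_regular_norm_ker fpfC.
  (* The complex regular representation is the rational one with scalars extended, so nonvanishing
     of [norm_ker] descends. *)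
  pose f : {rmorphism rat -> complex R} := ratr.
  rewrite -(map_mx_eq0 f) (eqmx_eq0 (map_norm_ker f _)).
  suffices ->: norm_ker (map_repr f (regular_repr rat G)) =
               norm_ker (regular_repr (complex R) G) by [].
  apply: eq_bigr => x _; congr kermx; apply: eq_bigr => y _.
  exact: map_regular_repr.
have [U simU sU]: exists2 U, mxsimple (regular_repr rat G) U
    (* [mxsimple_exists] yields a simple submodule only under a classical modality, hence [NNPP]. *)
    & (U <= norm_ker (regular_repr rat G))%MS.
  apply: NNPP => noU; suffices: false by [].
  apply: (mxsimple_exists (norm_ker_module _) nzU) => -[U simU sU].
  by case: noU; exists U.
have [modU ntU _] := simU.
exists (\rank U), (submod_repr modU); have irrU: irr_rat_FPF (submod_repr modU).
  by split; [apply/submod_mx_irr | apply: submod_norm_fpf].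
by split=> // m rH irrH; apply: rat_fpf_rsim.
Qed.
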